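(* Let $S$ be a permutation of a finite set $V$ with $|V|=L$ consisting of a single cycle of length $L$, let $\varnothing\ne U\subseteq V$, and let $\alpha=\mathrm{Ret}_U(S)$, with return times $\ell(u)$, $u\in U$. Fix $u_*\in U$ and the open gap from $u_*$ to $\alpha(u_* )$ (the distinguished gap). Let $F$ be a set of size $q$ with a distinguished element $0$. For each $x\in V$ choose a permutation $g_x\in\mathrm{Sym}(F)$, such that $g_x$ is the identity for every $x$ outside the open distinguished gap (in particular at both marked endpoints). Suppose the ordered product of the $g_x$ along that gap is a $q$-cycle on $F$. Then the permutation $\widehat S$ of $V\times F$ given by $$\widehat S(x,t)=(Sx,g_x(t))$$ is a single cycle of length $qL$. On $U\times\{0\}$, naturally identified with $U$, its first-return map is $\alpha$, and its return times are $$\widehat\ell(u)=\ell(u)+(q-1)L\,\mathbf 1_{\{u=u_*\}}\qquad(u\in U).$$ Every point $(x,t)\in V\times F$ with $t\ne0$ lies in the open gap of $\widehat S$ (with respect to $U\times\{0\}$) from $(u_*,0)$ to $(\alpha(u_* ),0)$.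
   Context: For a permutation $S$ and a subset $U$, the first-return map $\mathrm{Ret}_U(S)$ sends $u\in U$ to the next element of $U$ encountered on iterating $S$ from $u$; that is, $\alpha(u)=S^{\ell(u)}(u)$, where $\ell(u)\ge1$ (the return time) is the least positive integer with $S^{\ell(u)}(u)\in U$. The open gap from $u$ to $\alpha(u)$ is the set $\{S^j(u):0<j<\ell(u)\}$ of intermediate vertices, excluding the two marked endpoints. The ordered product of the $g_x$ along the gap from $u_*$ is the composition $g_{x_{k}}\circ\cdots\circ g_{x_1}$ with $x_j=S^j(u_* )$, $k=\ell(u_* )-1$ (the identity if $k=0$). *)

(* Defs.v *)
From mathcomp Require Import all_boot all_fingroup.

Set Implicit Arguments.
Unset Strict Implicit.
Unset Printing Implicit Defensive.

Local Open Scope group_scope.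

(* [T] is required to be nonempty: [porbits s] is [set0] on an empty type. *)
Definition single_cycle (T : finType) (s : {perm T}) (n : nat) : Prop :=
  porbits s = [set [set: T]] /\ #|T| = n.

(* The search stops at #[S], where S ^+ #[S] = 1 returns every point of U to U;
   the value is meaningful only for u in U (see [return_timeP]). *)
Definition return_time (V : finType) (S : {perm V}) (U : {set V}) (u : V) : nat :=
  (find (fun j => (S ^+ j.+1) u \in U) (iota 0 #[S])).+1.

Lemma return_timeP (V : finType) (S : {perm V}) (U : {set V}) (u : V) :
  u \in U ->
  [/\ (0 < return_time S U u)%N, (S ^+ return_time S U u) u \in U
    & forall j, (0 < j)%N -> (S ^+ j) u \in U -> (return_time S U u <= j)%N].
Proof.
move=> uU; rewrite /return_time.
set P := fun j => _; set s := iota 0 #[S].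
have hasP : has P s.
  apply/hasP; exists #[S].-1; last by rewrite /P prednK // expg_order perm1.
  by rewrite mem_iota /= add0n prednK.
have ltf : (find P s < #[S])%N by rewrite -[X in (_ < X)%N](size_iota 0) -has_find.
split=> //; first by have := nth_find 0 hasP; rewrite nth_iota ?add0n.
case=> // j _ jU; rewrite ltnS leqNgt; apply/negP => ltj.
have := before_find 0 ltj.
by rewrite nth_iota ?add0n ?(ltn_trans ltj) // /P jU.
Qed.

Definition first_return (V : finType) (S : {perm V}) (U : {set V}) (u : V) : V :=
  (S ^+ return_time S U u) u.

Definition open_gap (V : finType) (S : {perm V}) (U : {set V}) (u : V) : {set V} :=
  [set (S ^+ (j : nat)) u | j : 'I_(return_time S U u) & (0 < j)%N].

(* In {perm F}, (s * t) y = t (s y), so the factor with j = 1 acts first. *)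
Definition gap_product (V F : finType) (S : {perm V}) (U : {set V})
    (g : V -> {perm F}) (u : V) : {perm F} :=
  \prod_(1 <= j < return_time S U u) g ((S ^+ j) u).

Definition skew_fun (V F : finType) (S : {perm V}) (g : V -> {perm F})
    (p : V * F) : V * F :=
  (S p.1, g p.1 p.2).

Lemma skew_fun_inj (V F : finType) (S : {perm V}) (g : V -> {perm F}) :
  injective (skew_fun S g).
Proof. by move=> [x s] [y t] [/perm_inj <- /perm_inj <-]. Qed.

Definition skew_perm (V F : finType) (S : {perm V}) (g : V -> {perm F}) :
    {perm V * F} :=
  perm (@skew_fun_inj V F S g).

(* Main.v *)
Require Import Defs.
From mathcomp Require Import all_boot all_fingroup.
From mathcomp Require Import zify.

(** Write [c n x = g (S^(n-1) x) o ... o g (S x) o g x] for the cocycle of [g],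
    so that the skew product [T] satisfies [T^n (x, t) = (S^n x, c n x t)].
    One full turn of [S] from [ustar] meets the distinguished gap exactly once,
    at its very beginning; hence [c n ustar] is already the gap product [h]
    as soon as [n] reaches the return time of [ustar], and stays [h] up to
    [n = L] ([cocycle_past_gap]).  In particular
    [T^(k L + j) (ustar, t) = (S^j ustar, c j ustar (h^k t))].

    Since [S] reaches every [x] from [ustar] and the [q]-cycle [h] reaches every
    point of [F], this formula shows that [T] is transitive, so it is a single
    cycle.  It also locates the returns of [(ustar, zero)] to [U x {zero}].
    With [1 <= j <= L], a return at time [k L + j] needs [S^j ustar \in U],
    so [j] is at least the return time of [ustar]; the second coordinate is
    then [h^(k+1) zero], which is not [zero] for [k + 1 < q].
    The first return therefore takes place during the turn [k = q - 1], which
    accounts for the extra [(q - 1) L] steps.  After it, [T] stays on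
    [V x {zero}] until time [q L], so every point off the zero fibre has been
    visited before it.

    From any other [u \in U], the orbit segment up to the first return avoids
    the distinguished gap, because gaps of distinct points are disjoint
    ([open_gap_disjoint]); the cocycle is trivial there and nothing changes. *)

Set Implicit Arguments.
Unset Strict Implicit.
Unset Printing Implicit Defensive.

Local Open Scope group_scope.

(** * Powers of a single cycle *)

Section SingleCycle.

Variables (T : finType) (s : {perm T}) (n : nat).

Lemma transitive_single_cycle (x : T) :
  #|T| = n -> (forall y, exists i, (s ^+ i) x = y) -> single_cycle s n.
Proof.
move=> cardT trans_s; split=> //.
have orbx : porbit s x = [set: T].
  by apply/setP=> y; rewrite inE; have [i <-] := trans_s y; rewrite mem_porbit.
apply/setP=> A; rewrite inE; apply/imsetP/eqP=> [[y _ ->]|->]; last by exists x.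
by rewrite -orbx; apply/eqP; rewrite eq_porbit_mem orbx inE.
Qed.

Hypothesis cycs : single_cycle s n.

Lemma porbit_single_cycle (x : T) : porbit s x = [set: T].
Proof.
case: cycs => orbs _; apply/set1P; rewrite -orbs; exact: imset_f.
Qed.

Lemma card_porbit_single_cycle (x : T) : #|porbit s x| = n.
Proof. by rewrite porbit_single_cycle cardsT; case: cycs. Qed.

Lemma single_cycle_reach (x y : T) : exists2 i, (i < n)%N & (s ^+ i) x = y.
Proof.
have: y \in traject s x #|porbit s x|.
  by rewrite -porbit_traject porbit_single_cycle inE.
rewrite card_porbit_single_cycle => /trajectP[i lt_in ->].
by exists i; rewrite ?permX.
Qed.

Lemma single_cycle_expg_inj (x : T) (i j : nat) :
  (i < n)%N -> (j < n)%N -> (s ^+ i) x = (s ^+ j) x -> i = j.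
Proof.
move=> lt_in lt_jn; rewrite !permX => eq_ij.
have := uniq_traject_porbit s x; rewrite card_porbit_single_cycle => uniq_t.
apply/eqP; rewrite -(nth_uniq x _ _ uniq_t) ?size_traject //.
by rewrite !nth_traject // eq_ij.
Qed.

Lemma single_cycle_expg_id (x : T) : (s ^+ n) x = x.
Proof. by rewrite permX -(card_porbit_single_cycle x) iter_porbit. Qed.

Lemma single_cycle_gt0 (x : T) : (0 < n)%N.
Proof. by have [i lt_in _] := single_cycle_reach x x; case: n lt_in. Qed.

Lemma single_cycle_expg_neq (x : T) (i : nat) :
  (0 < i < n)%N -> (s ^+ i) x <> x.
Proof.
case/andP=> i_gt0 lt_in fix_x.
suff i0 : i = 0 by rewrite i0 in i_gt0.
apply: (@single_cycle_expg_inj x); rewrite ?expg0 ?perm1 //.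
exact: single_cycle_gt0 x.
Qed.

End SingleCycle.

(** * First returns and gaps *)

Section Returns.

Variables (V : finType) (S : {perm V}) (U : {set V}).

Lemma return_time_eq (u : V) (n : nat) :
  u \in U -> (0 < n)%N -> (S ^+ n) u \in U ->
  (forall j, (0 < j < n)%N -> (S ^+ j) u \notin U) ->
  return_time S U u = n.
Proof.
move=> uU n_gt0 nU minn; have [r_gt0 rU leqr] := return_timeP S uU.
apply/eqP; rewrite eqn_leq leqr //= leqNgt; apply/negP=> lt_rn.
by have := minn (return_time S U u); rewrite r_gt0 lt_rn rU => /(_ isT).
Qed.

Lemma before_return (u : V) (j : nat) :
  u \in U -> (0 < j < return_time S U u)%N -> (S ^+ j) u \notin U.
Proof.
move=> uU /andP[j_gt0 ltj]; apply/negP=> jU.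
by have [_ _ /(_ j j_gt0 jU)] := return_timeP S uU; rewrite leqNgt ltj.
Qed.

Lemma open_gapP (u x : V) :
  reflect (exists2 j, (0 < j < return_time S U u)%N & x = (S ^+ j) u)
          (x \in open_gap S U u).
Proof.
apply: (iffP imsetP) => [[j]|[j /andP[j_gt0 ltj] ->]].
  by rewrite inE => j_gt0 ->; exists j; rewrite ?j_gt0 /=.
by exists (Ordinal ltj); rewrite ?inE.
Qed.

Lemma open_gap_notin (u x : V) : u \in U -> x \in open_gap S U u -> x \notin U.
Proof. by move=> uU /open_gapP[j ltj ->]; apply: before_return. Qed.

(** A common point of two gaps could be followed backwards until one of the
    two starting points is met, inside the gap of the other one. *)
Lemma open_gap_disjoint (u v x : V) :
  u \in U -> v \in U -> x \in open_gap S U u -> x \in open_gap S U v -> u = v.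
Proof.
move=> uU vU /open_gapP[i lti ->] /open_gapP[j ltj].
wlog le_ij : u v i j uU vU lti ltj / (i <= j)%N.
  move=> th; case/orP: (leq_total i j) => le_ij eq_ij; first exact: th eq_ij.
  by symmetry; apply: th (esym eq_ij).
rewrite -(subnK le_ij) expgD permM => /perm_inj def_u.
case: (posnP (j - i)) => [ji0|ji_gt0].
  by move: def_u; rewrite ji0 expg0 perm1.
have: (S ^+ (j - i)) v \notin U by apply: before_return => //; lia.
by rewrite -def_u uU.
Qed.

End Returns.

(** * The cocycle of a skew product *)

Section Skew.

Variables (V F : finType) (S : {perm V}) (g : V -> {perm F}).

Definition cocycle (n : nat) (x : V) : {perm F} :=
  \prod_(0 <= i < n) g ((S ^+ i) x).

Lemma skew_permX (n : nat) (x : V) (t : F) :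
  (skew_perm S g ^+ n) (x, t) = ((S ^+ n) x, cocycle n x t).
Proof.
elim: n => [|n IHn]; first by rewrite /cocycle big_geq // !expg0 !perm1.
rewrite !expgSr !permM IHn permE /skew_fun /=.
by rewrite /cocycle big_nat_recr //= permM.
Qed.

Lemma cocycle1 (n : nat) (x : V) :
  (forall i, (i < n)%N -> g ((S ^+ i) x) = 1) -> cocycle n x = 1.
Proof.
by move=> g1; rewrite /cocycle big_nat_cond big1 // => i; rewrite andbT => /g1.
Qed.

(** Whole periods of [x] contribute powers of the monodromy [cocycle n x]. *)
Lemma skew_permX_period (n k j : nat) (x : V) (t : F) :
  (S ^+ n) x = x ->
  (skew_perm S g ^+ (k * n + j)) (x, t)
    = ((S ^+ j) x, cocycle j x ((cocycle n x ^+ k) t)).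
Proof.
move=> fix_x; rewrite expgD permM -skew_permX; congr (_ _).
elim: k => [|k IHk]; first by rewrite mul0n !expg0 !perm1.
by rewrite mulSn addnC expgD permM IHk skew_permX fix_x expgSr permM.
Qed.

End Skew.

(** * Inserting a cycle in the distinguished gap *)

Section DistinguishedGap.

Variables (V F : finType) (S : {perm V}) (L : nat).
Hypothesis cycS : single_cycle S L.
Variables (U : {set V}) (ustar : V).
Hypothesis ustarU : ustar \in U.
Variable g : V -> {perm F}.
Hypothesis g_id : forall x : V, x \notin open_gap S U ustar -> g x = 1.

Local Notation h := (gap_product S U g ustar).
Local Notation l := (return_time S U ustar).
Local Notation T := (skew_perm S g).

Lemma return_time_leq : (l <= L)%N.
Proof.
have [_ _ minl] := return_timeP S ustarU.
apply: minl; first exact: single_cycle_gt0 cycS ustar.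
by rewrite (single_cycle_expg_id cycS).
Qed.

Lemma cocycle_past_gap (n : nat) : (l <= n <= L)%N -> cocycle S g n ustar = h.
Proof.
case/andP=> le_ln le_nL; have [l_gt0 _ _] := return_timeP S ustarU.
rewrite /cocycle (big_cat_nat (n := l)) //=.
rewrite [X in _ * X]big_nat_cond [X in _ * X]big1 ?mulg1; last first.
  move=> i; rewrite andbT => /andP[le_li lt_in]; apply: g_id.
  apply/open_gapP=> -[j /andP[_ lt_jl] eq_ij].
  suff: i = j by lia.
  by apply: (single_cycle_expg_inj cycS) eq_ij; lia.
rewrite big_ltn // expg0 perm1 g_id ?mul1g //.
by apply/negP=> /(open_gap_notin ustarU); rewrite ustarU.
Qed.

Lemma skew_permX_ustar (k j : nat) (t : F) :
  (T ^+ (k * L + j)) (ustar, t)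
    = ((S ^+ j) ustar, cocycle S g j ustar ((h ^+ k) t)).
Proof.
rewrite skew_permX_period ?(single_cycle_expg_id cycS) //.
by rewrite (@cocycle_past_gap L) ?return_time_leq ?leqnn.
Qed.

Lemma skew_permX_past_gap (k j : nat) (t : F) : (l <= j <= L)%N ->
  (T ^+ (k * L + j)) (ustar, t) = ((S ^+ j) ustar, (h ^+ k.+1) t).
Proof.
by move=> bnd_j; rewrite skew_permX_ustar cocycle_past_gap // expgSr permM.
Qed.

Lemma cocycle_other_gap (u : V) (j : nat) :
  u \in U -> u != ustar -> (j <= return_time S U u)%N -> cocycle S g j u = 1.
Proof.
move=> uU neq_u le_j; apply: cocycle1 => i lt_ij; apply: g_id.
apply/negP=> gap_i; case: (posnP i) => [i0|i_gt0].
  move: gap_i; rewrite i0 expg0 perm1.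
  by move/(open_gap_notin ustarU); rewrite uU.
case/eqP: neq_u; apply: (open_gap_disjoint uU ustarU _ gap_i).
by apply/open_gapP; exists i; rewrite // i_gt0 (leq_trans lt_ij).
Qed.

Variables (q : nat) (zero : F).
Hypothesis g_cyc : single_cycle h q.

Local Notation U0 := (setX U [set zero]).

Lemma skew_perm_reach (x : V) (t : F) :
  exists k j, [/\ (k < q)%N, (j < L)%N
    & (T ^+ (k * L + j)) (ustar, zero) = (x, t)].
Proof.
have [j lt_jL <-] := single_cycle_reach cycS ustar x.
have [k lt_kq def_t] :=
  single_cycle_reach g_cyc zero ((cocycle S g j ustar)^-1 t).
by exists k, j; split=> //; rewrite skew_permX_ustar def_t permKV.
Qed.

Lemma skew_perm_single_cycle : single_cycle T (q * L).
Proof.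
apply: (@transitive_single_cycle _ _ _ (ustar, zero)) => [|[x t]].
  by rewrite card_prod mulnC; case: cycS g_cyc => _ -> [_ ->].
by have [k [j [_ _ <-]]] := skew_perm_reach x t; exists (k * L + j)%N.
Qed.

Lemma skew_return_time_other (u : V) : u \in U -> u != ustar ->
  return_time T U0 (u, zero) = return_time S U u.
Proof.
move=> uU neq_u; have [r_gt0 rU _] := return_timeP S uU.
apply: return_time_eq => // [||j lt_j].
- by rewrite !inE uU eqxx.
- by rewrite skew_permX cocycle_other_gap // perm1 !inE rU eqxx.
by rewrite skew_permX !inE negb_and (before_return uU lt_j).
Qed.

Lemma skew_return_time_ustar :
  return_time T U0 (ustar, zero) = ((q - 1) * L + l)%N.
Proof.
have [l_gt0 lU minl] := return_timeP S ustarU.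
have le_lL := return_time_leq; have q_gt0 := single_cycle_gt0 g_cyc zero.
apply: return_time_eq => [|||n /andP[n_gt0 lt_n]].
- by rewrite !inE ustarU eqxx.
- by rewrite addn_gt0 l_gt0 orbT.
- rewrite skew_permX_past_gap ?leqnn // subn1 prednK //.
  by rewrite (single_cycle_expg_id g_cyc) !inE lU eqxx.
(* The remainder is taken in [1, L] rather than [0, L): at the end of a turn
   the power of h has already increased. *)
have [k [j [def_n j_gt0 le_jL]]] :
    exists k j, [/\ n = (k * L + j)%N, (0 < j)%N & (j <= L)%N].
  exists (n.-1 %/ L)%N, (n.-1 %% L)%N.+1; split=> //.
    by rewrite addnS -divn_eq prednK.
  by rewrite ltn_pmod // (leq_trans l_gt0).
rewrite def_n; apply/negP=> retn; have jU : (S ^+ j) ustar \in U.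
  by move: retn; rewrite skew_permX_ustar !inE => /andP[].
have le_lj := minl j j_gt0 jU; move: retn.
rewrite skew_permX_past_gap ?le_lj // !inE => /andP[_ /eqP fix0].
apply: (single_cycle_expg_neq g_cyc _ fix0); rewrite /= -subn_gt0 subnS.
by move: lt_n; rewrite def_n; nia.
Qed.

Lemma skew_first_return (u : V) : u \in U ->
  first_return T U0 (u, zero) = (first_return S U u, zero).
Proof.
move=> uU; rewrite /first_return; have [->|neq_u] := eqVneq u ustar.
  have q_gt0 := single_cycle_gt0 g_cyc zero.
  rewrite skew_return_time_ustar skew_permX_past_gap ?leqnn ?return_time_leq //.
  by rewrite subn1 prednK // (single_cycle_expg_id g_cyc).
rewrite skew_return_time_other // skew_permX.
by rewrite cocycle_other_gap // perm1.
Qed.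

(** A point reached only after the first return belongs to the last turn,
    past the gap, where the fibre coordinate is [h^q zero = zero]. *)
Lemma nonzero_in_open_gap (x : V) (t : F) :
  t != zero -> (x, t) \in open_gap T U0 (ustar, zero).
Proof.
move=> t_neq0; have [k [j [lt_kq lt_jL def_xt]]] := skew_perm_reach x t.
apply/open_gapP; exists (k * L + j)%N => //; rewrite skew_return_time_ustar.
apply/andP; split.
  rewrite lt0n; apply/eqP=> kj0; move: def_xt t_neq0.
  by rewrite kj0 expg0 perm1 => -[_ ->]; rewrite eqxx.
rewrite ltnNge; apply/negP=> le_n.
have def_k : k.+1 = q by nia.
have le_lj : (l <= j)%N by move: le_n; rewrite -def_k subn1 /= leq_add2l.
move: def_xt t_neq0; rewrite skew_permX_past_gap ?le_lj ?(ltnW lt_jL) // def_k.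
by rewrite (single_cycle_expg_id g_cyc) => -[_ ->]; rewrite eqxx.
Qed.

End DistinguishedGap.

Local Close Scope group_scope.

Theorem theorem5p7 (V : finType) (L : nat) (S : {perm V})
    (cardV : #|V| = L) (cycS : single_cycle S L)
    (U : {set V}) (U_neq0 : U != set0) (ustar : V) (ustarU : ustar \in U)
    (F : finType) (q : nat) (cardF : #|F| = q) (zero : F)
    (g : V -> {perm F})
    (g_id : forall x : V, x \notin open_gap S U ustar -> g x = 1%g)
    (g_cyc : single_cycle (gap_product S U g ustar) q) :
  [/\ single_cycle (skew_perm S g) (q * L),
      forall u : V, u \in U ->
        first_return (skew_perm S g) (setX U [set zero]) (u, zero)
          = (first_return S U u, zero),
      forall u : V, u \in U ->
        return_time (skew_perm S g) (setX U [set zero]) (u, zero)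
          = return_time S U u + (q - 1) * L * (u == ustar)
    & forall (x : V) (t : F), t != zero ->
        (x, t) \in open_gap (skew_perm S g) (setX U [set zero]) (ustar, zero)].
Proof.
split.
- exact: (skew_perm_single_cycle cycS ustarU g_id zero g_cyc).
- exact: (skew_first_return cycS ustarU g_id zero g_cyc).
- move=> u uU; have [->|neq_u] := eqVneq u ustar.
    by rewrite muln1 addnC (skew_return_time_ustar cycS ustarU g_id zero g_cyc).
  by rewrite muln0 addn0 (skew_return_time_other ustarU g_id zero uU neq_u).
exact: (nonzero_in_open_gap cycS ustarU g_id g_cyc).
Qed.
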